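(* Let $i,j\in[N]$ be such that $i-j\notin\{1,0,-1\}$. Then $E_iA^*E_j=0$.
   Context: Let $\mathbb F_q$ be a finite field with $q$ elements, let $N,M$ be positive integers, let $H$ be a vector space over $\mathbb F_q$ of dimension $N+M$, and fix a subspace $h\subseteq H$ of dimension $M$. Let $X$ be the set of subspaces $y\subseteq H$ with $y\cap h=0$, partially ordered by inclusion (the Attenuated Space poset $\mathcal A_q(N,M)$). For $y,z\in X$, $z$ covers $y$ when $y\subseteq z$ and $\dim z-\dim y=1$; $y,z$ are adjacent when one of them covers the other. Let $\mathrm{Mat}_X(\mathbb C)$ be the algebra of complex matrices with rows and columns indexed by $X$, acting on $V=\mathbb C^X$ by left multiplication. The matrix $A\in\mathrm{Mat}_X(\mathbb C)$ has $(y,z)$-entry $1$ if $y$ covers $z$; $q^{\dim y}$ if $z$ covers $y$; and $0$ if $y,z$ are not adjacent. The matrix $A^*\in\mathrm{Mat}_X(\mathbb C)$ is diagonal with $(y,y)$-entry $q^{-\dim y}$. Let $[N]=\{i: 2i\in\mathbb Z,\ 0\le i\le N\}=\{0,1/2,1,\ldots,N\}$. The matrix $A$ is diagonalizable with mutually distinct eigenvalues $\theta_i=\frac{q^{N-i}-q^i}{q-1}q^{M/2}$ $(i\in[N])$, where $q^{1/2}>0$. For $i\in[N]$, $E_i\in\mathrm{Mat}_X(\mathbb C)$ is the primitive idempotent of $A$ for $\theta_i$ (the projection acting as the identity on the $\theta_i$-eigenspace and as $0$ on the other eigenspaces). *)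

(* Defs.v *)
From HB Require Import structures.
From mathcomp Require Import all_boot all_order all_algebra.
From mathcomp Require Import complex.
From mathcomp Require Import reals exp.

Set Implicit Arguments.
Unset Strict Implicit.
Unset Printing Implicit Defensive.

Import Order.TTheory GRing.Theory Num.Theory VectorInternalTheory.

Local Open Scope ring_scope.
Local Open Scope complex_scope.

Section FiniteSubspaces.
Variables (F : finFieldType) (H : vectType F).

HB.instance Definition _ := [Countable of {vspace H} by <:].
HB.instance Definition _ := [Finite of {vspace H} by <:].

End FiniteSubspaces.

Section AttenuatedSpace.
Variables (F : finFieldType) (H : vectType F) (h : {vspace H}).

Record attenuated_space : predArgType := AttenuatedSpace {
  att_vspace :> {vspace H};
  _ : (att_vspace :&: h == 0)%VS
}.

HB.instance Definition _ := [isSub for att_vspace].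
HB.instance Definition _ := [Finite of attenuated_space by <:].

Definition covers (z y : attenuated_space) : bool :=
  (y <= z)%VS && (\dim z - \dim y == 1)%N.

Variable R : realType.

(* Rows and columns are indexed by the poset through the enumeration
   enum_val : 'I_#|attenuated_space| -> attenuated_space. *)
Definition att_adjacency : 'M[R[i]]_#|attenuated_space| :=
  \matrix_(a, b)
    let y : attenuated_space := enum_val a in
    let z : attenuated_space := enum_val b in
    if covers y z then 1
    else if covers z y then #|F|%:R ^+ \dim y
    else 0.

Definition att_dual_adjacency : 'M[R[i]]_#|attenuated_space| :=
  \matrix_(a, b)
    let y : attenuated_space := enum_val a in
    if a == b then #|F|%:R ^- \dim y else 0.

End AttenuatedSpace.

Section Eigenvalues.
Variable R : realType.

(* The index set {0, 1/2, 1, ..., N}, as a subset of R. *)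
Definition half_integers_upto (N : nat) : pred R :=
  [pred i | [&& 2 * i \is a Num.int, 0 <= i & i <= N%:R]].

(* Real powers of q > 0, so that q^{1/2} is the positive square root. *)
Definition att_eigenvalue (q N M : nat) (i : R) : R :=
  (powR q%:R (N%:R - i) - powR q%:R i) / (q%:R - 1) * powR q%:R (M%:R / 2).

End Eigenvalues.

(* Matrices act on column vectors by left multiplication, whereas [eigenspace]
   is about row vectors.  For diagonalizable A the eigenspaces span, so
   the two conditions determine E. *)
Definition is_primitive_idempotent (C : fieldType) (n : nat)
    (A : 'M[C]_n) (theta : C) (E : 'M[C]_n) : Prop :=
  (forall v : 'cV[C]_n, A *m v = theta *: v -> E *m v = v) /\
  (forall (mu : C) (v : 'cV[C]_n),
     mu != theta -> A *m v = mu *: v -> E *m v = 0).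

(* Main.v *)
Require Import Defs.
From mathcomp Require Import all_boot all_order all_algebra all_field.
From mathcomp Require Import complex.
From mathcomp Require Import reals exp.
From mathcomp Require Import zify ring.

(* Write A = R + B, where R sends a subspace to the sum of its covers and B is
   q^dim times the lowering map, and K = A^*.  Then RK = qKR and BK = q^-1 KB,
   and counting paths of three covering steps in the poset gives
     q(q+1) RBR = q^3 R^2B + BR^2 + q^(N+M)(q+1) R
   together with its adjoint for the weights q^(dim choose 2), for which A is
   self-adjoint (hence diagonalizable).  These yield the tridiagonal relation
     A^3K - KA^3 = (q+1+q^-1)(A^2KA - AKA^2) + q^(N+M-2)(q+1)^2 (AK - KA).
   Sandwiched between E_i and E_j it says that E_i K E_j is annihilated by
   (theta_i - theta_j)(theta_i - theta_(j+1))(theta_i - theta_(j-1)). *)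

Set Implicit Arguments.
Unset Strict Implicit.
Unset Printing Implicit Defensive.

Import Order.TTheory GRing.Theory Num.Theory.

Local Open Scope ring_scope.

(** * Counting vectors and covers inside a subspace over a finite field *)

Lemma card_vspace_finvect (F : finFieldType) (H : vectType F) (U : {vspace H}) :
  #|[set a : finvect_type H | a \in U]| = (#|F| ^ \dim U)%N.
Proof.
by case: H U => T cT U; rewrite cardsE (@card_vspace F (finvect_type (Vector.Pack cT))).
Qed.

Section CoverCount.
Variables (F : finFieldType) (H : vectType F).
Implicit Types y v t : {vspace H}.
Local Notation fH := (finvect_type H).

Definition covers_in y t : {set {vspace H}} :=
  [set v | [&& (y <= v)%VS, (v <= t)%VS & \dim v == (\dim y).+1]].

Lemma card_vspaceD y t : (y <= t)%VS ->
  #|[set a : fH | (a \in t) && (a \notin y)]| =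
    (#|F| ^ \dim t - #|F| ^ \dim y)%N.
Proof.
move=> yt; have -> : [set a : fH | (a \in t) && (a \notin y)] =
    [set a : fH | a \in t] :\: [set a : fH | a \in y].
  by apply/setP=> a; rewrite !inE andbC.
have sub : [set a : fH | a \in y] \subset [set a : fH | a \in t].
  by apply/subsetP=> a; rewrite !inE; apply: (subvP yt).
by rewrite cardsD (setIidPr sub) !card_vspace_finvect.
Qed.

Lemma dim_add_line y (a : H) : a \notin y -> \dim (y + <[a]>)%VS = (\dim y).+1.
Proof.
move=> ay; have a0 : a != 0 by apply: contraNneq ay => ->; rewrite mem0v.
rewrite dimv_disjoint_sum ?dim_vline ?a0 ?addn1 //.
apply/eqP; rewrite -subv0; apply/subvP => x.
rewrite memv_cap => /andP[xy /vlineP[c xc]]; rewrite memv0 xc.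
have [->|c0] := eqVneq c 0; first by rewrite scale0r.
case/negP: ay; move: xy; rewrite xc => cay.
by rewrite -(scale1r a) -(mulVf c0) -scalerA rpredZ.
Qed.

(* Each cover v of y inside t is y + <a> for exactly q^(dim y + 1) - q^(dim y) of
   the vectors a of t outside y. *)
Lemma card_covers_in y t : (y <= t)%VS ->
  #|covers_in y t| = (\sum_(i < \dim t - \dim y) #|F| ^ i)%N.
Proof.
move=> yt; have q1 : (1 < #|F|)%N by apply: finNzRing_gt1.
have dyt := dimvS yt.
have qy : (0 < #|F|.-1 * #|F| ^ \dim y)%N.
  by rewrite muln_gt0 expn_gt0; apply/andP; split; lia.
apply/eqP; rewrite -(eqn_pmul2r qy); apply/eqP.
rewrite [RHS]mulnA [X in _ = (X * _)%N]mulnC -predn_exp -[X in _ = (X * _)%N]subn1.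
rewrite mulnBl mul1n -expnD subnK //.
rewrite -card_vspaceD // -[RHS]sum1_card.
rewrite (partition_big (fun a : fH => (y + <[a : H]>)%VS)
   [in covers_in y t]) => [|a]; last first.
  rewrite !inE => /andP[at_ ay]; rewrite addvSl subv_add yt /=.
  by rewrite dim_add_line // eqxx andbT -memvE.
rewrite -sum_nat_const; apply: eq_bigr => v; rewrite inE => /and3P[yv vt /eqP dv].
rewrite sum1dep_card -[LHS](_ : #|[set a : fH | (a \in v) && (a \notin y)]| = _); last first.
  by rewrite card_vspaceD // dv expnS -subn1 mulnBl mul1n.
apply: eq_card => a; rewrite !inE; apply/andP/andP.
  move=> [av ay]; rewrite ay (subvP vt) //; split=> //.
  by rewrite eqEdim dim_add_line // dv leqnn subv_add yv -memvE av.
move=> [/andP[at_ ay] /eqP <-]; split=> //.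
by rewrite [_ \in _]memvE addvSr.
Qed.

End CoverCount.

Lemma sum_nat_unique (T : finType) (P : pred T) (x : T) :
  P x -> (forall z, P z -> z = x) -> (\sum_z P z = 1)%N.
Proof.
move=> Px uniq_x; rewrite (bigD1 x) //= Px big1 // => z; apply: contraNeq.
by rewrite eqb0 negbK => /uniq_x ->.
Qed.

(** * Counting covers and zigzag paths in the attenuated space poset *)

Section PosetCount.
Variables (F : finFieldType) (H : vectType F) (h : {vspace H}).
Local Notation X := (attenuated_space h).
Implicit Types u v w x y z : X.
Local Notation q := #|F|.

Lemma coversE z y : covers z y = (y <= z)%VS && (\dim z == (\dim y).+1).
Proof.
rewrite /covers; case: (boolP (y <= z)%VS) => //= yz.
by have := dimvS yz; lia.
Qed.

Lemma covers_dim z y : covers z y -> \dim z = (\dim y).+1.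
Proof. by rewrite coversE => /andP[_ /eqP]. Qed.

Lemma covers_sub z y : covers z y -> (y <= z)%VS.
Proof. by case/andP. Qed.

Lemma att_cap0 y : (y :&: h = 0)%VS.
Proof. by apply/eqP; apply: (valP y). Qed.

Lemma att_dim_add y : \dim (y + h)%VS = (\dim y + \dim h)%N.
Proof. by rewrite dimv_disjoint_sum // att_cap0. Qed.

Lemma att_sub_cap0 u (t : {vspace H}) : (t <= u)%VS -> (t :&: h == 0)%VS.
Proof. by move=> tu; rewrite -subv0 -(att_cap0 u) capvS. Qed.

Lemma att_inj u v : (u : {vspace H}) = v -> u = v.
Proof. by move=> uv; apply: val_inj. Qed.

(** The space v + h contains y + h, and dim (v + h) = dim y + 1 + dim h - dim (v :&: h). So v meets
    h nontrivially exactly when v + h collapses to y + h. *)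
Lemma cover_disjointP y (v : {vspace H}) : (y <= v)%VS -> \dim v = (\dim y).+1 ->
  (v :&: h == 0)%VS = ~~ (v <= y + h)%VS.
Proof.
move=> yv dv; have := dimv_sum_cap v h; have dyh := att_dim_add y.
have := dimvS (addvS yv (subvv h)) => le_yh sum_cap.
apply/eqP/idP => [vh0|]; last apply: contraNeq; last first.
  rewrite -dimv_eq0 -lt0n => cap_gt0.
  have /eqP-> : (y + h == v + h)%VS by rewrite eqEdim addvS //=; lia.
  exact: addvSl.
apply/negP => vyh; have : (v + h <= y + h)%VS by rewrite subv_add vyh addvSr.
by move/dimvS; move: sum_cap; rewrite vh0 dimv0; lia.
Qed.

(** By [cover_disjointP], the subspaces covering y inside t that fall outside the poset are exactly
    those contained in y + h; the second summand restores them. *)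
Lemma sum_covers_below y (t : {vspace H}) : (y <= t)%VS ->
  (\sum_v (covers v y && (v <= t)%VS) + #|covers_in y (t :&: (y + h))| =
    #|covers_in y t|)%N.
Proof.
move=> yt; rewrite -(cardsID (covers_in y (y + h)) (covers_in y t)) addnC.
congr addn.
  apply: eq_card => v; rewrite !inE subv_cap.
  by do !case: (_ <= _)%VS => //=; rewrite ?andbb ?andbF.
rewrite -big_mkcond /= sum1_card -(card_imset _ att_inj) /=.
apply: eq_card => v; rewrite !inE; apply/imsetP/idP => [[w]|].
  rewrite unfold_in coversE -andbA => /and3P[yw /eqP dw wt] ->.
  have := cover_disjointP yw dw; rewrite att_cap0 eqxx => /esym/negbTE->.
  by rewrite yw wt dw eqxx.
case/andP => v_yh /and3P[yv vt /eqP dv]; move: v_yh; rewrite yv dv eqxx andbT /=.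
rewrite -(cover_disjointP yv dv) => vh0; exists (AttenuatedSpace vh0) => //.
by rewrite unfold_in coversE /= yv vt dv eqxx.
Qed.

(** When t lies in the poset the correction vanishes: by the modular law t :&: (y + h) = y + (t :&:
    h) = y. *)
Lemma sum_covers_between y (t : X) : (y <= t)%VS ->
  (\sum_v (covers v y && (v <= t)%VS) = \sum_(i < \dim t - \dim y) q ^ i)%N.
Proof.
move=> yt; rewrite -card_covers_in // -sum_covers_below //.
suff -> : (t :&: (y + h))%VS = y by rewrite card_covers_in // subnn big_ord0 addn0.
by rewrite capvC -vspace_modl // capvC att_cap0 addv0.
Qed.

Definition covers2 (t y : X) := (y <= t)%VS && (\dim t == (\dim y).+2).

Lemma sum_covers_covers y (t : X) :
  (\sum_v (covers v y && covers t v) = q.+1 * covers2 t y)%N.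
Proof.
rewrite /covers2; case: (boolP (y <= t)%VS) => [yt|yt] /=; last first.
  rewrite muln0 big1 // => v _; apply/eqP; rewrite eqb0; apply: contra yt.
  by case/andP=> /covers_sub yv /covers_sub; apply: subv_trans.
case: eqP => [dt|dt]; last first.
  rewrite muln0 big1 // => v _; apply/eqP; rewrite eqb0; apply/negP.
  by case/andP=> /covers_dim dv /covers_dim; lia.
rewrite muln1 -[q.+1](_ : (\sum_(i < \dim t - \dim y) q ^ i = _)%N); last first.
  by rewrite dt -addn2 addKn !big_ord_recl big_ord0 expn0 expn1 addn0.
rewrite -sum_covers_between //; apply: eq_bigr => v _; congr nat_of_bool.
apply: andb_id2l => /covers_dim dv; rewrite coversE dv dt eqxx andbT //.
Qed.

Lemma dimv_cap_lt (u v : {vspace H}) : \dim u = \dim v -> u != v ->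
  (\dim (u :&: v) < \dim u)%N.
Proof.
move=> duv; rewrite ltnNge; apply: contraNN => cap_ge.
have /eqP capu : (u :&: v == u)%VS by rewrite eqEdim capvSl.
by rewrite eqEdim duv leqnn andbT -capu capvSr.
Qed.

(** The only candidate for w is v :&: u, which belongs to the poset because it lies in u. *)
Lemma sum_covers_meet u v : \dim u = \dim v -> u != v ->
  (\sum_w (covers v w && covers u w) = ((\dim (v :&: u)).+1 == \dim u))%N.
Proof.
move=> duv neq_uv; have dcap : (\dim (v :&: u) < \dim u)%N.
  by rewrite capvC dimv_cap_lt //; apply: contraNneq neq_uv => /att_inj->.
case: eqP => [dmeet|dmeet]; last first.
  rewrite big1 // => w _; apply/eqP; rewrite eqb0; apply/negP.
  case/andP=> vw uw; have : (w <= v :&: u)%VS by rewrite subv_cap !covers_sub.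
  by move/dimvS; have := covers_dim uw; lia.
have cap0 := att_sub_cap0 (capvSr v u).
apply: (@sum_nat_unique _ _ (AttenuatedSpace cap0)).
  by rewrite !coversE /= capvSl capvSr -duv dmeet eqxx.
move=> w /andP[vw uw]; apply: att_inj; apply/eqP; rewrite eqEdim /=.
by rewrite subv_cap !covers_sub //=; have := covers_dim uw; lia.
Qed.

(** This is [sum_covers_below] for t the whole space, where the excluded covers lie between y and y
    + h, of relative dimension dim h. *)
Lemma sum_covers y :
  (\sum_v covers v y + \sum_(i < \dim h) q ^ i =
    \sum_(i < \dim {:H} - \dim y) q ^ i)%N.
Proof.
have := sum_covers_below (subvf y); rewrite !card_covers_in ?subvf //; last first.
  by rewrite subv_cap subvf addvSl.
rewrite (capv_idPr (subvf _)) att_dim_add addKn => <-.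
by congr addn; apply: eq_bigr => v _; rewrite subvf andbT.
Qed.

(* A path y < v > w < u with w != y corresponds to x = w :&: y together with a w
   in the pencil between x and u, other than y. *)
Lemma zigzag_cover u y : covers u y ->
  (\sum_w \sum_v [&& covers v y, covers v w & covers u w] =
    q * \sum_x (covers y x && covers2 u x) + \sum_t (covers t u && covers2 t y)
      + q ^ (\dim {:H} - \dim u))%N.
Proof.
move=> uy; have du := covers_dim uy; have yu := covers_sub uy.
(* Since u covers y, every cover t of u automatically lies two steps above y. *)
have -> : (\sum_t (covers t u && covers2 t y) = \sum_t covers t u)%N.
  apply: eq_bigr => t _; rewrite /covers2; case: (boolP (covers t u)) => //= tu.
  by rewrite (subv_trans yu (covers_sub tu)) (covers_dim tu) du eqxx.
(* Of the q + 1 elements between x and u, one is y, which leaves q choices of w. Conversely each w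
   != y below u arises from the single x = y :&: w. *)
have -> : (q * \sum_x (covers y x && covers2 u x) =
    \sum_(w | w != y) covers u w)%N.
  transitivity (\sum_(w | w != y) \sum_x [&& covers u w, covers y x & covers w x])%N.
    rewrite exchange_big big_distrr /=; apply: eq_bigr => x _.
    have := sum_covers_covers x u; rewrite (bigD1 y) //= uy andbT mulSn.
    case: (boolP (covers y x)) => [yx|_] /=; last first.
      by move=> _; rewrite muln0 [RHS]big1 // => w _; rewrite andbF.
    have -> : covers2 u x.
      by rewrite /covers2 (subv_trans (covers_sub yx) yu) du (covers_dim yx) eqxx.
    rewrite muln1 => /addnI <-; apply: eq_bigr => w _.
    by rewrite andbC.
  apply: eq_bigr => w wy; case: (boolP (covers u w)) => [uw|_] /=; last by rewrite big1.
  have dw := covers_dim uw; have dwy : \dim w = \dim y by lia.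
  have cap_lt : (\dim (y :&: w) < \dim y)%N.
    by rewrite dimv_cap_lt //; apply: contraNneq wy => /att_inj ->.
  rewrite sum_covers_meet //; have := dimv_sum_cap y w.
  have : (y + w <= u)%VS by rewrite subv_add yu covers_sub.
  by move/dimvS => ? ?; rewrite (_ : _ == _) //; lia.
have [cy cu] := (sum_covers y, sum_covers u).
have leH : (\dim u <= \dim {:H})%N by rewrite dimvS ?subvf.
(* The two geometric sums counting covers of y and of u differ by one top term; this is the source
   of the correction that occurs only when u covers y. *)
have cyu : (\sum_v covers v y = \sum_t covers t u + q ^ (\dim {:H} - \dim u))%N.
  move: cy; rewrite (_ : _ - \dim y = (\dim {:H} - \dim u).+1)%N; last by lia.
  by rewrite big_ord_recr /= -cu addnAC => /addIn.
(* The term v = u contributes every w below u. Any other v has v :&: u = y, so it contributes the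
   single path with w = y. *)
rewrite -addnA -cyu exchange_big /= (bigD1 u) //= [X in _ = (_ + X)%N](bigD1 u) //= uy addnA.
congr addn.
  by rewrite [in LHS](bigD1 y) //= uy addnC; congr addn; apply: eq_bigr => w _; rewrite andbb.
apply: eq_bigr => v vu; case: (boolP (covers v y)) => [vy|_] /=; last by rewrite big1.
have dv := covers_dim vy.
have cap_lt : (\dim (v :&: u) < \dim v)%N.
  by rewrite dimv_cap_lt ?dv //; apply: contraNneq vu => /att_inj ->.
rewrite sum_covers_meet ?dv ?du 1?eq_sym //.
have : (y <= v :&: u)%VS by rewrite subv_cap yu covers_sub.
by move/dimvS => ?; rewrite (_ : _ == _) //; lia.
Qed.

(* Here v ranges over the covers of y inside y + u and forces w = v :&: u; when
   (y + u) :&: h is a line, exactly one such v meets h. *)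
Lemma zigzag_not_cover u y : \dim u = (\dim y).+1 -> ~~ (y <= u)%VS ->
  (\sum_w \sum_v [&& covers v y, covers v w & covers u w] =
    q * \sum_x (covers y x && covers2 u x) +
      \sum_t (covers t u && covers2 t y))%N.
Proof.
move=> du yu; have sum_cap := dimv_sum_cap y u.
have sum_gt : (\dim u < \dim (y + u))%N.
  rewrite ltnNge; apply: contraNN yu => le_u.
  have /eqP -> : ((u : {vspace H}) == y + u)%VS by rewrite eqEdim addvSr.
  exact: addvSl.
have -> : (\sum_w \sum_v [&& covers v y, covers v w & covers u w] =
    \sum_v (covers v y && ((\dim (v :&: u)).+1 == \dim u)))%N.
  rewrite exchange_big; apply: eq_bigr => v _ /=.
  case: (boolP (covers v y)) => [vy|_] /=; last by rewrite big1.
  rewrite -sum_covers_meet //; first by rewrite du (covers_dim vy).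
  by apply: contraNneq yu => ->; apply: covers_sub.
(* Equivalently, y :&: u has codimension one in y. Otherwise u and y are too far apart and all three
   sums vanish. *)
case: (boolP (\dim (y + u) == (\dim y).+2)) => [/eqP dyu|dyu]; last first.
  rewrite !big1 ?muln0 // => v _; apply/eqP; rewrite eqb0; apply/negP.
  - case/andP=> /covers_sub uv /andP[yv /eqP dv].
    have : (y + u <= v)%VS by rewrite subv_add yv uv.
    by move/dimvS; lia.
  - case/andP=> yv /andP[uv _]; have dv := covers_dim yv.
    have : (v <= y :&: u)%VS by rewrite subv_cap uv covers_sub.
    by move/dimvS; lia.
  case/andP=> vy /eqP dvu; have := dimv_sum_cap v u; have := covers_dim vy.
  by have := dimvS (addvS (covers_sub vy) (subvv u)); lia.
have -> : (\sum_x (covers y x && covers2 u x) = 1)%N.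
  have cap0 := att_sub_cap0 (capvSr y u).
  apply: (@sum_nat_unique _ _ (AttenuatedSpace cap0)).
    rewrite coversE /covers2 /= capvSl capvSr /=; lia.
  move=> x /andP[yx /andP[xu _]]; apply: att_inj; apply/eqP; rewrite eqEdim /=.
  by rewrite subv_cap xu covers_sub //=; have := covers_dim yx; lia.
have -> : (\sum_t (covers t u && covers2 t y) = ((y + u) :&: h == 0)%VS)%N.
  case: (boolP ((y + u) :&: h == 0)%VS) => [cap0|cap0]; last first.
    rewrite big1 // => t _; apply/eqP; rewrite eqb0; apply: contraNN cap0.
    case/andP=> tu /andP[yt _]; apply: (att_sub_cap0 (u := t)).
    by rewrite subv_add yt covers_sub.
  apply: (@sum_nat_unique _ _ (AttenuatedSpace cap0)).
    by rewrite coversE /covers2 /= addvSl addvSr dyu du !eqxx.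
  move=> t /andP[tu /andP[yt /eqP dt]]; apply: att_inj; apply/esym/eqP.
  by rewrite eqEdim /= subv_add yt covers_sub //= dyu dt.
(* A cover v of y meets u in a hyperplane of u exactly when v + u is no larger than y + u. *)
have -> : (\sum_v (covers v y && ((\dim (v :&: u)).+1 == \dim u)) =
    \sum_v (covers v y && (v <= y + u)%VS))%N.
  apply: eq_bigr => v _; congr nat_of_bool; apply: andb_id2l => vy.
  have dv := covers_dim vy; have sum_capv := dimv_sum_cap v u.
  have sub := addvS (covers_sub vy) (subvv u).
  apply/eqP/idP => [dvu|v_yu].
    have /eqP -> : (y + u == v + u)%VS by rewrite eqEdim sub; lia.
    exact: addvSl.
  have : (v + u <= y + u)%VS by rewrite subv_add v_yu addvSr.
  have : (\dim (v :&: u) < \dim v)%N.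
    rewrite dimv_cap_lt ?dv //; apply: contraNneq yu => <-; exact: covers_sub.
  by move=> ? /dimvS; lia.
have := sum_covers_below (addvSl y u); rewrite !card_covers_in ?addvSl //; last first.
  by rewrite subv_cap !addvSl.
rewrite dyu -addn2 addKn !big_ord_recl big_ord0 expn0 expn1 addn0.
rewrite [((y + u) :&: (y + h))%VS]capvC -vspace_modl ?addvSl // dimv_disjoint_sum; last first.
  by apply/eqP; rewrite -subv0 -(att_cap0 y) capvS // capvSl.
rewrite addKn muln1 [(h :&: _)%VS]capvC.
(* The intersection of y + u with h is disjoint from u, which has codimension one in y + u. *)
have : (\dim ((y + u) :&: h) <= 1)%N.
  have dis : (u :&: ((y + u) :&: h) = 0)%VS.
    by apply/eqP; rewrite -subv0 -(att_cap0 u) capvS // capvSr.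
  have := dimv_disjoint_sum dis.
  have : (u + ((y + u) :&: h) <= y + u)%VS by rewrite subv_add addvSr capvSl.
  by move/dimvS; lia.
rewrite -dimv_eq0; case: (\dim ((y + u) :&: h)) => [|[|//]] _ /=.
  by rewrite big_ord0; lia.
by rewrite big_ord_recl big_ord0 expn0; lia.
Qed.

(** Up to powers of q, the four terms are the (u, y) entries of RBR, R^2B, BR^2 and R. If dim u
    differs from dim y + 1, no path exists and every term is zero. *)
Lemma zigzag u y :
  (\sum_w \sum_v [&& covers v y, covers v w & covers u w] =
    q * \sum_x (covers y x && covers2 u x) +
      \sum_t (covers t u && covers2 t y) +
      covers u y * q ^ (\dim {:H} - \dim u))%N.
Proof.
case: (boolP (covers u y)) => [/zigzag_cover->|uy]; first by rewrite mul1n.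
rewrite mul0n addn0; have [du|du] := eqVneq (\dim u) (\dim y).+1.
  by apply: zigzag_not_cover => //; apply: contraNN uy; rewrite coversE du eqxx andbT.
rewrite big1 => [|w _].
  rewrite !big1 ?muln0 // => x _; apply/eqP; rewrite eqb0; apply/negP.
    by case/andP=> /covers_dim ? /andP[_ /eqP]; lia.
  by case/andP=> /covers_dim ? /andP[_ /eqP]; lia.
rewrite big1 // => v _; apply/eqP; rewrite eqb0; apply/negP.
by case/and3P=> /covers_dim ? /covers_dim ? /covers_dim; lia.
Qed.

End PosetCount.

(** * Linear algebra: diagonalization, idempotents and the tridiagonal relation *)

(** Conjugating A by the diagonal matrix of square roots of w gives a real symmetric, hence normal,
    matrix, to which the spectral theorem applies. *)
Lemma symmetrizable_diagonalizable (C : numClosedFieldType) (n : nat)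
    (A : 'M[C]_n) (w : 'I_n -> C) :
  (forall a, 0 < w a) -> A \is a mxOver Num.real ->
  (forall a b, w a * A a b = w b * A b a) ->
  exists2 P : 'M[C]_n, P \in unitmx & exists d, A *m P = P *m diag_mx d.
Proof.
move=> w_gt0 Areal symA; pose s a := sqrtC (w a).
have s_neq0 a : s a != 0 by rewrite sqrtC_eq0 gt_eqF.
have s_real a : s a \is Num.real by rewrite realE sqrtC_ge0 ltW.
pose V := diag_mx (\row_a s a); pose V' := diag_mx (\row_a (s a)^-1).
have VV' : V *m V' = 1%:M.
  apply/matrixP=> a b; rewrite mul_diag_mx !mxE.
  by case: eqVneq => [->|_]; rewrite ?mulr0 //= mulr1n divff.
have V'V : V' *m V = 1%:M by apply: mulmx1C.
pose S := V *m A *m V'.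
have S_entry a b : S a b = s a * A a b / s b.
  by rewrite /S mul_mx_diag mxE mul_diag_mx !mxE.
have S_normal : S \is normalmx.
  apply: symmetric_normalmx; last first.
    by apply/mxOverP=> a b; rewrite S_entry rpredM ?rpredV ?rpredM // (mxOverP Areal).
  apply/is_hermitianmxP; rewrite expr0 scale1r map_mx_id //.
  apply/matrixP=> a b; rewrite [RHS]mxE !S_entry.
  have := symA a b; rewrite -(sqrtCK (w a)) -(sqrtCK (w b)) -/(s a) -/(s b) => E.
  have sab := mulf_neq0 (s_neq0 a) (s_neq0 b); apply: (mulIf sab).
  transitivity (s a ^+ 2 * A a b); first by field.
  by rewrite E; field.
have unitP := spectral_unit S.
exists (V' *m invmx (spectralmx S)).
  by rewrite unitmx_mul unitmx_inv unitP andbT; case: (mulmx1_unit VV').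
exists (spectral_diag S).
have : S *m invmx (spectralmx S) =
    invmx (spectralmx S) *m diag_mx (spectral_diag S).
  by rewrite {1}(orthomx_spectralP S_normal) mulmxK.
move/(congr1 (mulmx V')); rewrite /S !mulmxA V'V mul1mx => ->.
by rewrite -mulmxA.
Qed.

(** In the basis of eigenvectors given by the columns of P, E becomes a diagonal matrix of zeros and
    ones. It therefore commutes with A, which yields the identity for E A as well as the one for A
    E. *)
Lemma primitive_idempotent_comm (C : fieldType) (n : nat) (A P E : 'M[C]_n)
    (d : 'rV_n) (theta : C) :
  P \in unitmx -> A *m P = P *m diag_mx d -> is_primitive_idempotent A theta E ->
  A *m E = theta *: E /\ E *m A = theta *: E.
Proof.
move=> unitP AP [E_id E_0]; pose delta := \row_k (d 0 k == theta)%:R : 'rV[C]_n.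
have A_col k : A *m col k P = d 0 k *: col k P.
  by rewrite [in LHS]colE mulmxA AP -colE; apply/colP=> a; rewrite mxE mul_mx_diag !mxE mulrC.
have EP : E *m P = P *m diag_mx delta.
  apply/matrixP=> a k; rewrite mul_mx_diag !mxE.
  have -> : \sum_j E a j * P j k = (E *m col k P) a 0.
    by rewrite mxE; apply: eq_bigr => j _; rewrite mxE.
  have [dk|dk] := eqVneq (d 0 k) theta.
    by rewrite E_id ?mxE ?mulr1 // A_col dk.
  by rewrite (E_0 (d 0 k)) // mxE mulr0.
have delta_d : diag_mx delta *m diag_mx d = theta *: diag_mx delta.
  apply/matrixP=> a b; rewrite mul_mx_diag !mxE.
  have [<-|_] := eqVneq a b; last by rewrite !mulr0n mul0r mulr0.
  by rewrite !mulr1n; have [->|_] := eqVneq; rewrite ?mul0r ?mulr0 // mulrC.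
split.
  apply: (can_inj (mulmxK unitP)).
  rewrite -mulmxA EP mulmxA AP -mulmxA diag_mxC delta_d -scalemxAr -EP.
  by rewrite scalemxAl.
apply: (can_inj (mulmxK unitP)).
rewrite -mulmxA AP mulmxA EP -mulmxA delta_d -scalemxAr -EP.
by rewrite scalemxAl.
Qed.

(** The commutation rules move every K to the far left. The words K R^3 and K B^3 then cancel, and
    the remaining words form a combination of the two cubic relations. *)
Lemma tridiagonal_relation_of_cubic (C : fieldType) (n : nat)
    (R B K : 'M[C]_n) (q c : C) :
  q != 0 ->
  R *m K = q *: (K *m R) -> B *m K = q^-1 *: (K *m B) ->
  (q * (q + 1)) *: (R *m B *m R) =
    q ^+ 3 *: (R *m R *m B) + B *m R *m R + (c * (q + 1)) *: R ->
  (q * (q + 1)) *: (B *m R *m B) =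
    q ^+ 3 *: (R *m B *m B) + B *m B *m R + (c * (q + 1)) *: B ->
  let A := R + B in
  A *m A *m A *m K - K *m A *m A *m A =
    (q + 1 + q^-1) *: (A *m A *m K *m A - A *m K *m A *m A) +
    (c * (q + 1) ^+ 2 / q ^+ 2) *: (A *m K - K *m A).
Proof.
move=> q0 RK BK rel_up rel_down A.
have RK' (W : 'M_n) : W *m R *m K = q *: (W *m K *m R).
  by rewrite -mulmxA RK -scalemxAr mulmxA.
have BK' (W : 'M_n) : W *m B *m K = q^-1 *: (W *m K *m B).
  by rewrite -mulmxA BK -scalemxAr mulmxA.
have {}rel_up := congr1 (mulmx K) rel_up; have {}rel_down := congr1 (mulmx K) rel_down.
rewrite !mulmxDr -!scalemxAr !mulmxA in rel_up rel_down.
rewrite /A !mulmxDl !mulmxDr.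
rewrite !mulmxDl.
rewrite !(RK', BK', RK, BK) -?scalemxAl -?scalemxAr ?mulmxA.
(* The words starting with K are treated as independent unknowns, which reduces the claim to a
   scalar identity in each entry. *)
move: (K *m R) (K *m B) (K *m R *m R *m R) (K *m B *m B *m B)
  (K *m R *m B *m R) (K *m R *m R *m B)
  (K *m B *m R *m R) (K *m B *m R *m B) (K *m R *m B *m B) (K *m B *m B *m R) rel_up rel_down.
move=> R1 B1 RRR BBB RBR RRB BRR BRB RBB BBR rel_up rel_down.
apply/matrixP=> a b; move: (congr1 (fun W : 'M_n => W a b) rel_up).
move: (congr1 (fun W : 'M_n => W a b) rel_down); rewrite !mxE.
move=> /eqP; rewrite -subr_eq0 => /eqP down0 /eqP; rewrite -subr_eq0 => /eqP up0.
apply/eqP; rewrite -subr_eq0; apply/eqP.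
(* The coefficients are found by comparing those of K R and K B, which occur in only one cubic
   relation each. *)
transitivity ((q ^+ 2 - 1) / q ^+ 2 * 0 - (q ^+ 2 - 1) / q ^+ 3 * 0 : C); last first.
  by rewrite !mulr0 subrr.
by rewrite -[X in _ = _ * X - _]up0 -[X in _ = _ - _ * X]down0; field.
Qed.

Lemma tridiagonal_idempotents (C : fieldType) (n : nat)
    (A K Ei Ej : 'M[C]_n) (ti tj kappa rho : C) :
  A *m A *m A *m K - K *m A *m A *m A =
    kappa *: (A *m A *m K *m A - A *m K *m A *m A) + rho *: (A *m K - K *m A) ->
  Ei *m A = ti *: Ei -> A *m Ej = tj *: Ej ->
  ((ti - tj) * (ti ^+ 2 + ti * tj + tj ^+ 2 - kappa * (ti * tj) - rho)) *:
    (Ei *m K *m Ej) = 0.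
Proof.
move=> rel EiA AEj.
have EiA' (W : 'M_n) : W *m Ei *m A = ti *: (W *m Ei).
  by rewrite -mulmxA EiA scalemxAr.
have AEj' (W : 'M_n) : W *m A *m Ej = tj *: (W *m Ej).
  by rewrite -mulmxA AEj scalemxAr.
have := congr1 (fun W => Ei *m W *m Ej) rel.
rewrite /= !(mulmxDr, mulmxDl, mulmxN, mulNmx, =^~ scalemxAr, =^~ scalemxAl, mulmxA).
rewrite !(EiA, AEj', =^~ scalemxAl, =^~ scalemxAr).
move=> /eqP; rewrite -subr_eq0 => /eqP rel0; rewrite -[RHS]rel0.
by apply/matrixP=> a b; rewrite !mxE; ring.
Qed.

(** * The raising and lowering matrices and their cubic relations *)

Section RaisingLowering.
Variables (C : numFieldType) (F : finFieldType) (H : vectType F) (h : {vspace H}).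
Local Notation X := (attenuated_space h).
Local Notation n := #|X|.
Local Notation q := (#|F|%:R : C).
Local Notation ev := (enum_val : 'I_n -> X).

Definition raising : 'M[C]_n := \matrix_(a, b) (covers (ev a) (ev b))%:R.

Definition lowering : 'M[C]_n :=
  \matrix_(a, b) (q ^+ \dim (ev a) * (covers (ev b) (ev a))%:R).

Definition dim_weight : 'M[C]_n := diag_mx (\row_a q ^- \dim (ev a)).
Local Notation K := dim_weight.

Lemma card_field_neq0 : q != 0.
Proof. by rewrite pnatr_eq0 -lt0n; apply: ltnW; apply: finNzRing_gt1. Qed.

(* Below, q and the dimensions are generalized before [ring] and [field], which
   would otherwise try to compute #|F|. *)
Lemma raising_dual : raising *m K = q *: (K *m raising).
Proof.
apply/matrixP=> a b; rewrite mul_mx_diag mxE [RHS]mxE mul_diag_mx !mxE.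
case: (boolP (covers _ _)) => [/covers_dim ->|_]; last by rewrite !(mul0r, mulr0).
by move: (\dim _) q card_field_neq0 => k p p0; rewrite exprS; field; rewrite p0 expf_neq0.
Qed.

Lemma lowering_dual : lowering *m K = q^-1 *: (K *m lowering).
Proof.
apply/matrixP=> a b; rewrite mul_mx_diag mxE [RHS]mxE mul_diag_mx !mxE.
case: (boolP (covers _ _)) => [/covers_dim ->|_]; last by rewrite !(mul0r, mulr0).
by move: (\dim _) q card_field_neq0 => k p p0; rewrite exprS; field; rewrite p0 expf_neq0.
Qed.

Lemma sum_enum_val (f : X -> C) : \sum_(a < n) f (ev a) = \sum_x f x.
Proof. by rewrite [RHS](reindex ev) //; apply: onW_bij; apply: enum_val_bij. Qed.

Lemma raising_sq_entry a b :
  (raising *m raising) a b = (#|F|.+1 * covers2 (ev a) (ev b))%N%:R.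
Proof.
rewrite -sum_covers_covers mxE natr_sum -sum_enum_val.
by apply: eq_bigr => v _; rewrite !mxE -natrM mulnC mulnb.
Qed.

(** Entrywise this is [zigzag] multiplied by q (q + 1) q^k, with k the dimension of the column
    subspace; [sum_covers_covers] supplies the factor q + 1 in the entries of R^2. *)
Lemma raising_lowering_cubic :
  (q * (q + 1)) *: (raising *m lowering *m raising) =
    q ^+ 3 *: (raising *m raising *m lowering) + lowering *m raising *m raising +
    (q ^+ \dim {:H} * (q + 1)) *: raising.
Proof.
apply/matrixP=> a b; have q0 := card_field_neq0.
(* All weights depend on k alone: B lands in dimension k within RBR, k - 1 within R^2B and k + 1
   within BR^2. *)
have [k dk] : exists k, \dim (ev b) = k by exists (\dim (ev b)).
have RBR : (raising *m lowering *m raising) a b = q ^+ k *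
    (\sum_w \sum_v [&& covers v (ev b), covers v w & covers (ev a) w])%N%:R.
  rewrite -mulmxA mxE natr_sum mulr_sumr -sum_enum_val.
  apply: eq_bigr => w _; rewrite mxE.
  case: (boolP (covers (ev a) (ev w))) => [aw|_]; last first.
    by rewrite mul0r big1 ?mulr0 // => v _; rewrite !andbF.
  rewrite mul1r mxE natr_sum mulr_sumr -sum_enum_val.
  apply: eq_bigr => v _; rewrite !mxE andbT andbC.
  case: (boolP (covers (ev v) (ev w))) => [vw|_]; last by rewrite mulr0 mul0r mulr0.
  rewrite mulr1; case: (boolP (covers (ev v) (ev b))) => [vb|_]; last by rewrite !mulr0.
  by congr (_ ^+ _ * _); have := covers_dim vw; have := covers_dim vb; lia.
(* The extra factor q turns the weight q^(k-1) into q^k and avoids a truncated exponent. *)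
have RRB : q * (raising *m raising *m lowering) a b = q ^+ k *
    (#|F|.+1 * \sum_x (covers (ev b) x && covers2 (ev a) x))%N%:R.
  rewrite mxE big_distrr big_distrr natr_sum mulr_sumr /= -sum_enum_val.
  apply: eq_bigr => x _; rewrite raising_sq_entry !mxE.
  case: (boolP (covers (ev b) (ev x))) => [bx|_] /=; last by rewrite !(mulr0, muln0).
  rewrite -dk (covers_dim bx) mulr1; move: (\dim _) => m.
  by rewrite exprS mulrCA mulrC.
have BRR : (lowering *m raising *m raising) a b = q ^+ k.+1 *
    (#|F|.+1 * \sum_t (covers t (ev a) && covers2 t (ev b)))%N%:R.
  rewrite -mulmxA mxE big_distrr natr_sum mulr_sumr /= -sum_enum_val.
  apply: eq_bigr => t _; rewrite raising_sq_entry !mxE.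
  case: (boolP (covers (ev t) (ev a))) => [/covers_dim dt|_] /=; last first.
    by rewrite muln0 mulr0 mul0r mulr0.
  case: (boolP (covers2 (ev t) (ev b))) => [/andP[_ /eqP dt2]|_] /=; last first.
    by rewrite !(muln0, mulr0).
  by rewrite mulr1; have -> : \dim (ev a) = k.+1 by rewrite -dk; lia.
rewrite [LHS]mxE [RHS]mxE [X in _ = X + _]mxE [X in _ = X + _ + _]mxE.
rewrite [X in _ = _ + X]mxE RBR BRR.
rewrite exprSr -[q ^+ 2 * q * _]mulrA RRB zigzag !natrD !natrM.
rewrite mxE; case: (boolP (covers (ev a) (ev b))) => [ab|_] /=; last first.
  by rewrite !(mul0r, mulr0, addr0) [q ^+ k.+1]exprS; move: q q0 => p p0; ring.
have -> : q ^+ \dim {:H} = q ^+ k.+1 * q ^+ (\dim {:H} - \dim (ev a)).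
  by rewrite -exprD -dk -(covers_dim ab) subnKC // dimvS ?subvf.
by rewrite natrX [q ^+ k.+1]exprS; move: (_ - _)%N q q0 => m p p0; ring.
Qed.


(** Since 'C(k + 1, 2) = 'C(k, 2) + k, the weight grows by q^k from dimension k to k + 1, which is
    exactly the weight of [lowering] there. *)
Definition adjacency_weight (a : 'I_n) : C := q ^+ 'C(\dim (ev a), 2).

Lemma adjacency_weight_gt0 a : 0 < adjacency_weight a.
Proof. by rewrite exprn_gt0 // lt0r card_field_neq0 ler0n. Qed.

Lemma lowering_adjoint a b :
  adjacency_weight a * raising a b = adjacency_weight b * lowering b a.
Proof.
rewrite /adjacency_weight !mxE.
case: (boolP (covers _ _)) => [/covers_dim ->|_]; last by rewrite !mulr0.
by rewrite binS bin1 exprD mulrA !mulr1.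
Qed.

(** Conjugation by the weights W exchanges [raising] with the transpose of [lowering] and
    conversely, so this is the transpose of [raising_lowering_cubic]. *)
Lemma lowering_raising_cubic :
  (q * (q + 1)) *: (lowering *m raising *m lowering) =
    q ^+ 3 *: (raising *m lowering *m lowering) + lowering *m lowering *m raising +
    (q ^+ \dim {:H} * (q + 1)) *: lowering.
Proof.
pose W := diag_mx (\row_a adjacency_weight a).
pose W' := diag_mx (\row_a (adjacency_weight a)^-1).
have w0 a : adjacency_weight a != 0 by rewrite gt_eqF ?adjacency_weight_gt0.
have WW' : W *m W' = 1%:M.
  apply/matrixP=> a b; rewrite mul_diag_mx !mxE.
  by case: eqVneq => [->|_]; rewrite ?mulr0 //= mulr1n divff.
have WR : W *m raising = lowering^T *m W.
  apply/matrixP=> a b; rewrite mul_diag_mx mul_mx_diag [LHS]mxE [RHS]mxE.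
  by rewrite [X in X * _ = _]mxE [X in _ = X * _]mxE [X in _ = _ * X]mxE
    lowering_adjoint mulrC.
have WB : W *m lowering = raising^T *m W.
  apply/matrixP=> a b; rewrite mul_diag_mx mul_mx_diag [LHS]mxE [RHS]mxE.
  by rewrite [X in X * _ = _]mxE [X in _ = X * _]mxE [X in _ = _ * X]mxE
    -lowering_adjoint mulrC.
apply: (can_inj (mulKmx (_ : W \in unitmx))); first by case: (mulmx1_unit WW').
rewrite !mulmxDr -!scalemxAr !mulmxA.
have WR' (M : 'M_n) : M *m W *m raising = M *m lowering^T *m W.
  by rewrite -mulmxA WR mulmxA.
have WB' (M : 'M_n) : M *m W *m lowering = M *m raising^T *m W.
  by rewrite -mulmxA WB mulmxA.
rewrite !(WR', WB', WR, WB) !scalemxAl -!mulmxDl; congr (_ *m W).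
have := congr1 trmx raising_lowering_cubic.
by rewrite !linearD !linearZ /= !trmx_mul !mulmxA => E; rewrite -!scalemxAl E.
Qed.

End RaisingLowering.

(** * Nonvanishing of the scalar factor at the eigenvalues *)

Lemma powR_inj (R : realType) (x : R) : 1 < x -> injective (powR x).
Proof.
move=> x1 r s /(congr1 (@ln R)); rewrite !ln_powR => /mulIf; apply.
by rewrite gt_eqF ?ln_gt0.
Qed.

Lemma att_eigenvalue_gap (R : realType) (q N M : nat) (i j : R) :
  (1 < q)%N -> i - j \notin [:: 1; 0; -1] ->
  let ti := att_eigenvalue q N M i in
  let tj := att_eigenvalue q N M j in
  (ti - tj) * (ti ^+ 2 + ti * tj + tj ^+ 2 - (q%:R + 1 + q%:R^-1) * (ti * tj)
    - q%:R ^+ (N + M) * (q%:R + 1) ^+ 2 / q%:R ^+ 2) != 0.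
Proof.
move=> q_gt1 ij; rewrite /att_eigenvalue.
have p_gt1 : 1 < q%:R :> R by rewrite ltr1n.
move: (q%:R : R) p_gt1 => p p_gt1.
have p_gt0 : 0 < p by apply: lt_trans p_gt1.
have p_neq0 : p != 0 by rewrite gt_eqF.
have p1_neq0 : p - 1 != 0 by rewrite subr_eq0 gt_eqF.
have [x_gt0 y_gt0] := (powR_gt0 i p_gt0, powR_gt0 j p_gt0).
have s_gt0 := powR_gt0 (M%:R / 2) p_gt0.
have a_gt0 : 0 < p ^+ N by rewrite exprn_gt0.
have ss : p ^+ M = powR p (M%:R / 2) ^+ 2.
  by rewrite expr2 -powRD ?p_neq0 ?implybT // -splitr powR_mulrn // ltW.
(* With x = q^i and y = q^j, the excluded values 0, 1, -1 of i - j correspond to x = y, x = q y and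
   y = q x. *)
have xy : powR p i != powR p j.
  apply: contraNneq ij => /(powR_inj p_gt1) ->.
  by rewrite subrr !inE eqxx orbT.
have xpy : powR p i != p * powR p j.
  apply: contraNneq ij; rewrite -{2}(powRr1 (ltW p_gt0)) -powRD ?p_neq0 ?implybT //.
  by move/(powR_inj p_gt1) ->; rewrite addrK !inE eqxx.
have ypx : powR p j != p * powR p i.
  apply: contraNneq ij; rewrite -{2}(powRr1 (ltW p_gt0)) -powRD ?p_neq0 ?implybT //.
  by move/(powR_inj p_gt1) ->; rewrite opprD addrCA subrr addr0 !inE eqxx !orbT.
rewrite exprD ss !powRB ?p_neq0 ?implybT // powR_mulrn ?ltW //.
move: (powR p i) (powR p j) (powR p (M%:R / 2)) (p ^+ N) x_gt0 y_gt0 s_gt0 a_gt0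
  xy xpy ypx => x y s a x_gt0 y_gt0 s_gt0 a_gt0 xy xpy ypx.
have x_neq0 : x != 0 by rewrite gt_eqF.
have y_neq0 : y != 0 by rewrite gt_eqF.
set gap := (X in X != 0).
(* Here theta_i = s (a / x - x) / (p - 1), and theta_i - theta_j is s / (p - 1) times (y - x) (a /
   (x y) + 1). The other factors come from replacing y by p y and y / p, that is, j by j + 1 and j -
   1. The factors of the last line are positive. *)
have -> : gap = (s / (p - 1)) ^+ 3 *
    ((y - x) * (p * y - x) * ((y - p * x) / p)) *
    ((a / (x * y) + 1) * (a / (p * x * y) + 1) * (a * p / (x * y) + 1)).
  by rewrite /gap; field; rewrite x_neq0 y_neq0 p_neq0 p1_neq0.
have pos (b : R) : 0 < b -> b + 1 != 0 by move=> b_gt0; rewrite gt_eqF // addr_gt0.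
have s_neq0 : s != 0 by rewrite gt_eqF.
have yx_neq0 : y - x != 0 by rewrite subr_eq0 eq_sym.
have pyx_neq0 : p * y - x != 0 by rewrite subr_eq0 eq_sym.
have ypx_neq0 : y - p * x != 0 by rewrite subr_eq0.
by rewrite !mulf_neq0 ?expf_neq0 ?mulf_neq0 ?invr_neq0 // pos ?divr_gt0 ?mulr_gt0.
Qed.

(** * Identification of the matrices and conclusion *)

Local Open Scope complex_scope.

Lemma att_adjacencyE (R : realType) (F : finFieldType) (H : vectType F)
    (h : {vspace H}) :
  att_adjacency h R = raising R[i] h + lowering R[i] h.
Proof.
apply/matrixP=> a b; rewrite !mxE /=.
case: (boolP (covers (enum_val a) (enum_val b))) => [ab|_]; last first.
  by rewrite add0r; case: ifP; rewrite ?mulr1 ?mulr0.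
case: (boolP (covers (enum_val b) (enum_val a))) => [ba|_]; last by rewrite mulr0 addr0.
by have := covers_dim ab; have := covers_dim ba; lia.
Qed.



Lemma att_dual_adjacencyE (R : realType) (F : finFieldType) (H : vectType F)
    (h : {vspace H}) :
  att_dual_adjacency h R = dim_weight R[i] h.
Proof. by apply/matrixP=> a b; rewrite !mxE; case: eqVneq. Qed.


Theorem proposition10p1 (R : realType) (F : finFieldType) (N M : nat)
    (N_gt0 : (0 < N)%N) (M_gt0 : (0 < M)%N)
    (H : vectType F) (dimH : \dim {:H} = (N + M)%N)
    (h : {vspace H}) (dimh : \dim h = M)
    (i j : R)
    (hi : i \in half_integers_upto N) (hj : j \in half_integers_upto N)
    (hij : i - j \notin [:: 1; 0; -1])
    (Ei Ej : 'M[R[i]]_#|attenuated_space h|)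
    (hEi : is_primitive_idempotent (att_adjacency h R)
             (att_eigenvalue #|F| N M i)%:C Ei)
    (hEj : is_primitive_idempotent (att_adjacency h R)
             (att_eigenvalue #|F| N M j)%:C Ej) :
  Ei *m att_dual_adjacency h R *m Ej = 0.
Proof.
(* A is real, and the weights q^(dim choose 2) symmetrize it because they make R and B adjoint to
   each other. *)
have [P unitP [d AP]] : exists2 P, P \in unitmx &
    exists d, att_adjacency h R *m P = P *m diag_mx d.
  rewrite att_adjacencyE; apply: symmetrizable_diagonalizable.
  - exact: adjacency_weight_gt0.
  - apply/mxOverP=> a b; rewrite !mxE.
    by rewrite rpredD ?rpredM ?rpredX ?realn.
  move=> a b; rewrite [X in _ * X = _]mxE [X in _ = _ * X]mxE !mulrDr.
  by rewrite [RHS]addrC (lowering_adjoint _ a b) (lowering_adjoint _ b a).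
have [_ EiA] := primitive_idempotent_comm unitP AP hEi.
have [AEj _] := primitive_idempotent_comm unitP AP hEj.
have rel := tridiagonal_relation_of_cubic (card_field_neq0 R[i] F)
  (raising_dual R[i] h) (lowering_dual R[i] h)
  (raising_lowering_cubic R[i] h) (lowering_raising_cubic R[i] h).
rewrite /= -att_adjacencyE -att_dual_adjacencyE dimH in rel.
have /eqP := tridiagonal_idempotents rel EiA AEj.
rewrite scalemx_eq0 => /orP[gap0|/eqP //].
have := att_eigenvalue_gap N M (finNzRing_gt1 F) hij; rewrite /= => /negP[].
move: gap0; move: (att_eigenvalue _ _ _ _) (att_eigenvalue _ _ _ _) => tj ti.
(* The embedding of the reals is an injective ring morphism, so the vanishing complex scalar
   contradicts the real inequality. *)
rewrite -(inj_eq (@complexI R)) rmorph0.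
by rewrite !(rmorphM, rmorphB, rmorphD, rmorphXn, fmorphV, rmorph_nat, rmorph1).
Qed.
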